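(* Let $n\ge1$ and let $B_n^{321}(q)=\sum_{\pi}q^{\mathrm{bump}(\pi)}$ be the generating function of the bump statistic over the set of $321$-avoiding permutations $\pi\in S_n$. Then $$B_n^{321}(q)=1+\sum_{1\le k\le n/2}\frac{\binom{n}{k,\,k,\,n-2k}^2}{\binom{n-k+1}{k}^2}\,q^k .$$
   Context: $S_n$ is the set of permutations $\pi=\pi_1\cdots\pi_n$ (one-line notation) of $\{1,\ldots,n\}$; $\pi$ is $321$-avoiding if there are no indices $a<b<c$ with $\pi_a>\pi_b>\pi_c$. $\binom{n}{k,k,n-2k}=\frac{n!}{k!\,k!\,(n-2k)!}$ is the multinomial coefficient. Robinson–Schensted (RS) correspondence: tableaux are fillings of Young diagrams with distinct positive integers increasing along rows and down columns. To insert $k$ into a tableau $P$ (written $P\leftarrow k$), start with the top row: (I1) if $k$ is greater than or equal to the rightmost entry of the current row, or the current row is empty, append $k$ at the end of that row and stop; (I2) otherwise let $y$ be the leftmost entry of the current row with $k<y$, replace $y$ by $k$ (this is one bump), set $k:=y$, move down one row and go to (I1). For $\pi\in S_n$, let $P_0$ be the empty tableau and $P_i=P_{i-1}\leftarrow\pi_i$ for $1\le i\le n$. The statistic $\mathrm{bump}(\pi)$ is the total number of bumps that occur over all these insertions. *)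

(* Defs.v *)
From HB Require Import structures.
From mathcomp Require Import all_boot all_order all_algebra all_fingroup.

Set Implicit Arguments.
Unset Strict Implicit.
Unset Printing Implicit Defensive.

Import GRing.Theory Num.Theory.

Local Open Scope ring_scope.

(* A permutation of {1, ..., n} is represented by s : 'S_n, both positions and
   values being shifted down by one; the shift of values is undone here. *)
Definition one_line (n : nat) (s : 'S_n) : seq nat :=
  [seq (val (s i)).+1 | i <- enum 'I_n].

Definition avoids321 (n : nat) (s : 'S_n) : bool :=
  ~~ [exists a : 'I_n, exists b : 'I_n, exists c : 'I_n,
        [&& (a < b)%N, (b < c)%N, (s b < s a)%N & (s c < s b)%N]].

(* A tableau is the list of its rows from top to bottom; rows below the listed
   ones are empty. Returns P <- k together with the number of bumps. *)
Fixpoint rs_insert (P : seq (seq nat)) (k : nat) : seq (seq nat) * nat :=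
  if P is r :: P' then
    if nilp r || (last 0%N r <= k)%N then (rcons r k :: P', 0%N)
    else
      let i := find (fun y => (k < y)%N) r in
      let: (Q, b) := rs_insert P' (nth 0%N r i) in
      (set_nth 0%N r i k :: Q, b.+1)
  else ([:: [:: k]], 0%N).

Definition rs_step (st : seq (seq nat) * nat) (k : nat) : seq (seq nat) * nat :=
  let: (P, m) := st in
  let: (Q, b) := rs_insert P k in (Q, (m + b)%N).

Definition bump (n : nat) (s : 'S_n) : nat :=
  (foldl rs_step ([::], 0%N) (one_line s)).2.

Definition B321 (n : nat) : {poly rat} :=
  \sum_(s : 'S_n | avoids321 s) 'X^(bump s).

(* The coefficient binom(n; k, k, n - 2k), for 2k <= n (the subtraction is
   truncated otherwise). *)
Definition multinom_kk (n k : nat) : rat :=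
  (n`!)%:R / ((k`!)%:R * (k`!)%:R * ((n - 2 * k)`!)%:R).

(* Main.v *)
Require Import Defs.
From HB Require Import structures.
From mathcomp Require Import all_boot all_order all_algebra all_fingroup.
From mathcomp Require Import zify ring.

(** A 321-avoiding permutation never bumps an entry out of the second row of its
insertion tableau, so each of its bumps adds exactly one entry to that row:
the bump statistic is the length of the second row.  Hence the coefficient of
[q^k] counts the permutations whose Robinson-Schensted tableau has shape
[(n-k, k)].  With [f] the number of standard tableaux of that shape, this
number is [f^2], and [f] is the quotient of multinomial and binomial
coefficients squared in the statement.

The equality with [f^2] comes from undoing the insertions.  Insertion into two
rows, [insert2], fails exactly when a third row would appear, and is
undone by one of at most two [removals]: taking away the end of the first row,
or letting the end of the second row bump back into the first
([insert2_tableau], [removalsP]).  Undoing [n] insertions therefore lists all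
the words with a given tableau of shape [(n-k, k)], and their number satisfies
the recursion of the [ballot] numbers, whatever the entries of the tableau
([size_preimages]).  The standard tableaux themselves satisfy the same
recursion, by removal of their largest entry ([size_std_tabs]).  Both factors
are thus [ballot n k], whose closed form is [ballot_closed].

That avoiding 321 is the same as never needing a third row is proved by
induction on the word with two invariants ([rs2_increasing3]).  They compare the
pairs [y < z] with [y] in the first row and [z] in the second to the descents
of the word: every such [y] is at most the lower letter of some descent, and
the lower letter of every descent is at most some such [y].  Inserting [x] thus
bumps an entry smaller than one of the second row exactly when [x] is smaller
than the lower letter of a descent.

Words are read from their last letter throughout, so that the letter inserted
last is the head of the list; the pattern 321 then appears as an increasing
subsequence of length three. *)

Set Implicit Arguments.
Unset Strict Implicit.
Unset Printing Implicit Defensive.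

Import GRing.Theory Num.Theory.

Local Open Scope ring_scope.
Local Open Scope nat_scope.

(** * Ballot numbers *)

(** The numbers of ballot sequences: [n] votes, [k] of them for the second
candidate, who is never ahead.  The guard encodes that condition at every
prefix, and makes the recursion vanish outside of the shapes [(n-k, k)]. *)
Fixpoint ballot (n k : nat) : nat :=
  if 2 * k <= n then
    if n is n'.+1 then
      ballot n' k + (if k is k'.+1 then ballot n' k' else 0)
    else 1
  else 0.

Lemma ballotn0 n : ballot n 0 = 1.
Proof. by elim: n => //= n ->. Qed.

(** The bound includes [2 * k = n.+1], where both sides vanish: there the
recursion leaves the range of the ballot numbers, and the induction needs the
value zero. *)
Lemma ballot_closed n k : 2 * k <= n.+1 ->
  (n.+1 - k)`! * k`! * ballot n k = n`! * (n.+1 - 2 * k).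
Proof.
elim: n k => [|n IHn] k le_k.
  by have -> : k = 0 by lia.
have [le_k'|] := boolP (2 * k <= n.+1); last first.
  move=> gt_k; have -> : n.+2 - 2 * k = 0 by lia.
  by rewrite /= (negbTE gt_k) !muln0.
rewrite /= le_k' factS.
case: k le_k le_k' => [|k] le_k le_k'.
  have := IHn 0 isT; rewrite muln0 !subn0 !muln1 addn0 !factS => H.
  by nia.
have [p En] : exists p, n.+1 = p + (2 * k).+2 by exists (n - (2 * k).+1); lia.
have := IHn k.+1 le_k'; have := IHn k ltac:(lia).
have [-> -> ->] : [/\ n.+1 - k = (p + k.+1).+1, n.+1 - k.+1 = p + k.+1 &
    n.+2 - k.+1 = (p + k.+1).+1] by split; lia.
have [-> -> ->] : [/\ n.+1 - 2 * k = p.+2, n.+1 - 2 * k.+1 = p &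
    n.+2 - 2 * k.+1 = p.+1] by split; lia.
rewrite !factS => H1 H2.
(* The two products are the left-hand sides of the induction hypotheses. *)
transitivity ((p + k.+1).+1 * ((p + k.+1)`! * (k.+1 * k`!) * ballot n k.+1) +
              k.+1 * ((p + k.+1).+1 * (p + k.+1)`! * k`! * ballot n k)).
  by ring.
by rewrite H1 H2 En; ring.
Qed.

(** * Strictly increasing rows *)

Lemma sorted_nth r i j : sorted ltn r -> i < j -> j < size r ->
  nth 0 r i < nth 0 r j.
Proof.
move=> sr lij ljr; apply: (sorted_ltn_nth ltn_trans) => //.
by rewrite inE; lia.
Qed.

Lemma sorted_rcons r x : sorted ltn (rcons r x) =
  sorted ltn r && (nilp r || (last 0 r < x)).
Proof. by case: r => //= y r; rewrite rcons_path. Qed.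

Lemma sorted_le_last r (z : nat) : sorted ltn r -> z \in r -> z <= last 0 r.
Proof.
move=> sr /(nthP 0) [i lir <-]; rewrite -nth_last.
have {}lir : i < size r := lir.
have [->//|ne] := eqVneq i (size r).-1.
by apply: ltnW; apply: sorted_nth => //; lia.
Qed.

Lemma sorted_max_last (r : seq nat) (m : nat) : sorted ltn r -> m \in r ->
  (forall z, z \in r -> z <= m) -> exists2 r' : seq nat, r = rcons r' m & sorted ltn r'.
Proof.
move=> sr mr le_m; case/lastP: r sr mr le_m => // r x sr mr le_m.
have lex : x <= m by apply: le_m; rewrite mem_rcons inE eqxx.
have := sorted_le_last sr mr; rewrite last_rcons => lem.
have E : x = m by lia.
by exists r; rewrite ?E //; move: sr; rewrite sorted_rcons => /andP [].
Qed.

Lemma sorted_find x r : sorted ltn r -> x \notin r ->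
  forall j, j < size r -> (nth 0 r j < x) = (j < find (ltn x) r).
Proof.
move=> sr xr j ljr; have ne : nth 0 r j != x.
  by apply: contraNneq xr => <-; exact: mem_nth.
have [lt|ge] := ltnP j (find (ltn x) r).
  by have /negbT := before_find 0 lt; simpl; lia.
have := ljr; have := nth_find 0 (a := ltn x) (s := r).
rewrite has_find; move=> /(_ ltac:(lia)) /= lt ljr'.
have [E|ne'] := eqVneq j (find (ltn x) r); first by rewrite E; lia.
have := @sorted_nth r (find (ltn x) r) j sr ltac:(lia) ljr.
by lia.
Qed.

Lemma find_unique (a : pred nat) r i : i <= size r ->
  (forall j, j < i -> ~~ a (nth 0 r j)) -> (i < size r -> a (nth 0 r i)) ->
  find a r = i.
Proof.
move=> lir before at_i; apply/eqP; rewrite eqn_leq; apply/andP; split.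
  rewrite leqNgt; apply/negP => lt; have:= before_find 0 lt.
  by rewrite at_i //; have := find_size a r; lia.
rewrite leqNgt; apply/negP => lt; have := before _ lt.
by rewrite nth_find // has_find; lia.
Qed.

Lemma sorted_set_nth r i x : sorted ltn r -> i < size r ->
  (0 < i -> nth 0 r i.-1 < x) -> (i.+1 < size r -> x < nth 0 r i.+1) ->
  sorted ltn (set_nth 0 r i x).
Proof.
move=> sr lir lo hi; apply/(sortedP 0) => j.
rewrite size_set_nth !nth_set_nth /= => ltj.
have {}ltj : j.+1 < size r by lia.
case: eqP => [E|_]; first by rewrite ifN ?E; [apply: hi; lia | lia].
case: eqP => [E|_]; first by have := lo; rewrite -E; apply.
exact: sorted_nth.
Qed.

Lemma perm_set_nth (r : seq nat) i x : i < size r ->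
  perm_eq (nth 0 r i :: set_nth 0 r i x) (x :: r).
Proof.
move=> lir; rewrite set_nthE lir.
rewrite -[in X in perm_eq _ (_ :: X)](cat_take_drop i r) (drop_nth 0 lir).
rewrite -cat1s perm_sym -cat1s -[x :: _]cat1s -[nth _ _ _ :: drop _ _]cat1s.
by apply/seq.permP => p; rewrite !count_cat /=; lia.
Qed.

Lemma mem_set_nth_or (r : seq nat) i (x z : nat) : i < size r ->
  z \in set_nth 0 r i x -> z = x \/ z \in r.
Proof.
move=> lti zr; have := perm_mem (perm_set_nth x lti) z.
by rewrite !inE zr orbT => /esym/orP [/eqP|]; [left|right].
Qed.

Lemma mem_set_nth_old (r : seq nat) i (x z : nat) : i < size r ->
  z \in r -> z != nth 0 r i -> z \in set_nth 0 r i x.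
Proof.
move=> lti zr ne; have := perm_mem (perm_set_nth x lti) z.
by rewrite !inE zr orbT (negbTE ne).
Qed.

Lemma mem_set_nth_new (r : seq nat) i (x : nat) : i < size r ->
  x \in set_nth 0 r i x.
Proof.
move=> lti; have E : nth 0 (set_nth 0 r i x) i = x by rewrite nth_set_nth /= eqxx.
by rewrite -[X in X \in _]E mem_nth // size_set_nth; lia.
Qed.

Lemma rcons_take_last (r : seq nat) :
  0 < size r -> rcons (take (size r).-1 r) (last 0 r) = r.
Proof.
by case/lastP: r => // r x _; rewrite size_rcons last_rcons
  -[in take _ _]cats1 take_size_cat.
Qed.

(** * Insertion into two rows and its inverse *)

(** The default value of [nth] is never read in [columns], which only looks at
columns of height two; [size_rows] makes these start from the left. *)
Record tableau2 (P : seq nat * seq nat) : Prop := Tableau2 {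
  sorted_row1 : sorted ltn P.1;
  sorted_row2 : sorted ltn P.2;
  size_rows : size P.2 <= size P.1;
  columns : forall j, j < size P.2 -> nth 0 P.1 j < nth 0 P.2 j }.

Definition entries (P : seq nat * seq nat) := P.1 ++ P.2.

(** Insertion that gives up when the entry bumped from the first row would itself
bump.  The test [last 0 P.2 <= y] always succeeds on an empty second row. *)
Definition insert2 (x : nat) (P : seq nat * seq nat) :
    option (seq nat * seq nat) :=
  let i := find (ltn x) P.1 in
  if i < size P.1 then
    let y := nth 0 P.1 i in
    if last 0 P.2 <= y then Some (set_nth 0 P.1 i x, rcons P.2 y) else None
  else Some (rcons P.1 x, P.2).

Lemma perm_insert2 x P P' : insert2 x P = Some P' ->
  perm_eq (entries P') (x :: entries P).
Proof.
case: P => r1 r2; rewrite /insert2 /=; case: ifP => [lti|_]; last first.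
  by case=> <-; rewrite /entries /= -cats1 -catA perm_catCA.
case: ifP => // _ [<-]; have := perm_set_nth x lti => /seq.permP H.
by apply/seq.permP => p; move: (H p); rewrite /entries /= -cats1 !count_cat /=; lia.
Qed.

(** The last insertion either added an entry at the end of the first row, or
bumped [y], now the end of the second row.  In the latter case the inserted
letter took the place of [y], hence is the largest entry of the first row below
[y].  The test on the first option keeps the shape a partition. *)
Definition removals (P : seq nat * seq nat) :
    seq (nat * (seq nat * seq nat)) :=
  let y := last 0 P.2 in
  let i := (find (ltn y) P.1).-1 in
  (if size P.2 < size P.1
   then [:: (last 0 P.1, (take (size P.1).-1 P.1, P.2))] else [::]) ++
  (if 0 < size P.2
   then [:: (nth 0 P.1 i, (set_nth 0 P.1 i y, take (size P.2).-1 P.2))]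
   else [::]).

Lemma insert2_tableau (x : nat) P P' : tableau2 P -> x \notin entries P ->
  uniq (entries P) -> insert2 x P = Some P' ->
  tableau2 P' /\ (x, P) \in removals P'.
Proof.
case: P => r1 r2 [/= s1 s2 sz cols]; rewrite mem_cat negb_or.
case/andP=> x1 x2 uq; rewrite /insert2 /=.
have fd := sorted_find s1 x1; set i := find _ _ in fd *.
have lei : i <= size r1 by exact: find_size.
case: ifP => [lti|gei]; last first.
  have {lei gei} Ei : i = size r1 by lia.
  case=> <-; split.
  - split=> //=.
    + rewrite sorted_rcons s1 /= -nth_last /nilp.
      by case: posnP => // pos; rewrite fd; lia.
    + by rewrite size_rcons; lia.
    + by move=> j lj; rewrite nth_rcons ifT ?cols //; lia.
  - rewrite /removals /= !size_rcons ltnS sz last_rcons -cats1 /=.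
    by rewrite take_size_cat // inE eqxx.
case: ifP => // lasty [<-]; set y := nth 0 r1 i.
have lxy : x < y
  by rewrite /y; move: (nth_find 0 (a := ltn x) (s := r1)); apply; rewrite has_find.
have y2 : y \notin r2.
  move: uq; rewrite cat_uniq => /and3P [_ /hasPn /(_ y)/contraL + _]; apply.
  exact: mem_nth.
have ltlast : 0 < size r2 -> last 0 r2 < y.
  move=> h; rewrite ltn_neqAle lasty andbT; apply: contraNneq y2 => <-.
  by case: (r2) h => //= a r _; apply: mem_last.
(* The column above each old entry of the second row is out of reach: its top is
   smaller than that entry, while the bumped one exceeds the whole second row. *)
have le2i : size r2 <= i.
  rewrite leqNgt; apply/negP => lt; have := cols _ lt; have := ltlast ltac:(lia).
  rewrite -nth_last -/y; have [->|ne] := eqVneq i (size r2).-1; first by lia.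
  by have := @sorted_nth r2 i (size r2).-1 s2 ltac:(lia) ltac:(lia); lia.
have hi : i.+1 < size r1 -> y < nth 0 r1 i.+1 by move=> h; apply: sorted_nth.
have s1' : sorted ltn (set_nth 0 r1 i x).
  apply: sorted_set_nth => // h; first by rewrite fd; lia.
  by have := hi h; lia.
have sz1 : size (set_nth 0 r1 i x) = size r1 by rewrite size_set_nth; lia.
split.
- split=> //=.
  + rewrite sorted_rcons s2 /=; have [//|] := boolP (nilp r2).
    by rewrite -lt0n /=; apply: ltlast.
  + by rewrite sz1 size_rcons; lia.
  + move=> j; rewrite size_rcons nth_rcons nth_set_nth /= => ltj.
    case: (ltnP j (size r2)) => lj.
      by rewrite ifN; [exact: cols | lia].
    have -> : j = size r2 by lia.
    rewrite eqxx; case: eqP => // ne.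
    by have := @sorted_nth r1 (size r2) i s1 ltac:(lia) lti.
- rewrite /removals /= sz1 last_rcons size_rcons /=.
  have -> : find (ltn y) (set_nth 0 r1 i x) = i.+1.
    apply: find_unique => [|j lj|h]; first (by rewrite sz1); rewrite nth_set_nth /=.
      case: eqP => [_|ne]; first by lia.
      by have := @sorted_nth r1 j i s1 ltac:(lia) lti; rewrite -/y; lia.
    by rewrite sz1 in h; rewrite ifN; [exact: hi | lia].
  rewrite /= nth_set_nth /= eqxx -cats1 take_size_cat // set_set_nth eqxx.
  have -> : set_nth 0 r1 i y = r1.
    apply: (@eq_from_nth _ 0) => [|j]; first by rewrite size_set_nth; lia.
    by rewrite nth_set_nth /=; case: eqP => [->|].
  by rewrite mem_cat mem_seq1 eqxx orbT.
Qed.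

Lemma removalsP P (x : nat) (P' : seq nat * seq nat) : tableau2 P -> uniq (entries P) ->
  (x, P') \in removals P ->
  [/\ tableau2 P', perm_eq (x :: entries P') (entries P) & insert2 x P' = Some P].
Proof.
case: P => r1 r2 [/= s1 s2 sz cols] uq; rewrite mem_cat => /orP [].
  case: ifP => //= lt; rewrite inE => /eqP [-> ->].
  have E := @rcons_take_last r1 ltac:(lia).
  set x0 := last 0 r1 in E *; set r := take _ _ in E *.
  have szr : size r1 = (size r).+1 by rewrite -E size_rcons.
  have /andP[sr lst] : sorted ltn r && (nilp r || (last 0 r < x0)).
    by rewrite -sorted_rcons E.
  have fd : find (ltn x0) r = size r.
    apply: find_unique => // [j lj|]; last by lia.
    have := sorted_nth (i := j) (j := size r) s1.
    by rewrite -E !nth_rcons lj eqxx ltnn size_rcons => /(_ isT (leqnn _)) /=; lia.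
  split.
  - split=> //=; first by lia.
    move=> j lj; have := cols j lj; rewrite -E nth_rcons ifT //; lia.
  - by rewrite /entries /= -E -cats1 -catA /=
      -[x0 :: _ in X in perm_eq X _]cat1s -[x0 :: r2]cat1s perm_catCA.
  - by rewrite /insert2 /= fd ltnn E.
case: ifP => //= gt; rewrite inE => /eqP [-> ->].
have E := @rcons_take_last r2 gt.
set y := last 0 r2 in E *; set r := take _ _ in E *.
have szr : size r2 = (size r).+1 by rewrite -E size_rcons.
have y1 : y \notin r1.
  move: uq; rewrite cat_uniq => /and3P [_ /hasPn h _]; apply: h.
  by rewrite -E mem_rcons inE eqxx.
have fd := sorted_find s1 y1; set f := find _ _ in fd *.
have lef : f <= size r1 by exact: find_size.
(* The entry above [y] is smaller than [y], so the one to be replaced stands no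
   further left, and the remaining columns are untouched. *)
have lsf : size r < f.
  by rewrite -fd; [have := cols (size r); rewrite szr -E nth_rcons ltnn eqxx; apply|]; lia.
set i := f.-1; have Ef : f = i.+1 by lia.
have lti : i < size r1 by lia.
have lx : nth 0 r1 i < y by rewrite fd; lia.
have hi : i.+1 < size r1 -> y < nth 0 r1 i.+1.
  move=> h; have := fd _ h; rewrite Ef ltnn => /negbT.
  have : nth 0 r1 i.+1 != y by apply: contraNneq y1 => <-; exact: mem_nth.
  by lia.
have sz1 : size (set_nth 0 r1 i y) = size r1 by rewrite size_set_nth; lia.
have /andP[sr lst] : sorted ltn r && (nilp r || (last 0 r < y)).
  by rewrite -sorted_rcons E.
split.
- split=> //=.
  + apply: sorted_set_nth => // h.
    by have := @sorted_nth r1 i.-1 i s1 ltac:(lia) lti; lia.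
  + by rewrite sz1; lia.
  + move=> j lj; rewrite nth_set_nth /= ifN; last by lia.
    by have := cols j; rewrite -E size_rcons nth_rcons lj; apply; lia.
- have /seq.permP H := perm_set_nth y lti.
  apply/seq.permP => p; move: (H p).
  by rewrite /entries /= -E -cats1 !count_cat /=; lia.
- rewrite /insert2 /=.
  have -> : find (ltn (nth 0 r1 i)) (set_nth 0 r1 i y) = i.
    apply: find_unique => [|j lj|_]; rewrite ?sz1 ?nth_set_nth /=; try lia.
      rewrite ifN; last by lia.
      by have := @sorted_nth r1 j i s1 lj lti; lia.
    by rewrite eqxx.
  rewrite sz1 lti nth_set_nth /= eqxx set_set_nth eqxx E.
  have -> : set_nth 0 r1 i (nth 0 r1 i) = r1.
    apply: (@eq_from_nth _ 0) => [|j]; first by rewrite size_set_nth; lia.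
    by rewrite nth_set_nth /=; case: eqP => [->|].
  by rewrite ifT //; case: (r) lst => //= a l; lia.
Qed.

(** * The words with a given tableau *)

Definition rs2 (w : seq nat) : option (seq nat * seq nat) :=
  foldr (fun x => obind (insert2 x)) (Some ([::], [::])) w.

Lemma perm_rs2 w P : rs2 w = Some P -> perm_eq (entries P) w.
Proof.
elim: w P => [|x w IHw] P /=; first by case=> <-.
case: (rs2 w) IHw => //= Q /(_ Q erefl) Qw /perm_insert2 /perm_trans; apply.
by rewrite perm_cons.
Qed.

Lemma rs2_tableau w P : uniq w -> rs2 w = Some P -> tableau2 P.
Proof.
elim: w P => [|x w IHw] P /=; first by move=> _ [<-].
case/andP=> xw uw; have := @perm_rs2 w; case: (rs2 w) IHw => //= Q.
move=> /(_ Q uw erefl) tQ /(_ Q erefl) Qw.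
by case/insert2_tableau; rewrite ?(perm_mem Qw) ?(perm_uniq Qw).
Qed.

(** The words, last letter first, obtained by undoing [n] insertions from [P] in
all possible ways. *)
Fixpoint preimages (n : nat) (P : seq nat * seq nat) : seq (seq nat) :=
  if n is n'.+1 then
    [seq xQ.1 :: w | xQ <- removals P, w <- preimages n' xQ.2]
  else [:: [::]].

Lemma mem_preimages n P w : tableau2 P -> uniq (entries P) ->
  size (entries P) = n -> (w \in preimages n P) = (rs2 w == Some P).
Proof.
elim: n P w => [|n IHn] P w tP uP szP.
  have EP : P = ([::], [::]).
    case: P szP {tP uP} => r1 r2; rewrite size_cat /= => h.
    by congr pair; apply: size0nil; lia.
  rewrite inE EP; apply/eqP/eqP => [-> //|/perm_rs2/perm_size/esym/size0nil].
  by [].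
apply/allpairsPdep/eqP => [[[x Q] [v [/= rem vQ ->]]]|].
  have [tQ pQ ins] := removalsP tP uP rem.
  have uQ : uniq (entries Q) by move: uP; rewrite -(perm_uniq pQ) => /andP [].
  have sQ : size (entries Q) = n by have := perm_size pQ => /=; lia.
  by move: vQ; rewrite IHn //= => /eqP -> /=.
case: w => [|x w] E.
  by have := perm_size (perm_rs2 E); rewrite szP.
have uxw : uniq (x :: w) by rewrite -(perm_uniq (perm_rs2 E)).
case/andP: (uxw) => xw uw; move: E => /=; case E: (rs2 w) => [Q|] //= ins.
have Qw := perm_rs2 E; have tQ := rs2_tableau uw E.
have [] := insert2_tableau tQ _ _ ins; rewrite ?(perm_mem Qw) ?(perm_uniq Qw) //.
move=> _ rem; exists (x, Q), w; split=> //=.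
rewrite IHn ?E // ?(perm_uniq Qw) //.
by have := perm_size (perm_insert2 ins); rewrite szP /=; lia.
Qed.

(** A word determines its tableau after each insertion, and the two removals
leave second rows of different lengths. *)
Lemma uniq_preimages n P : tableau2 P -> uniq (entries P) ->
  size (entries P) = n -> uniq (preimages n P).
Proof.
elim: n P => //= n IHn P tP uP szP.
have sub xQ : xQ \in removals P ->
    [/\ tableau2 xQ.2, uniq (entries xQ.2) & size (entries xQ.2) = n].
  case: xQ => x Q /(removalsP tP uP) [tQ pQ _]; split=> //=.
    by move: uP; rewrite -(perm_uniq pQ) => /andP [].
  by have := perm_size pQ => /=; lia.
apply: allpairs_uniq_dep => [|xQ /sub []|]; last 2 first.
- exact: IHn.
- move=> xw1 xw2 /allpairsPdep [[x Q] [w [/= /sub[/= t1 u1 s1] wQ ->]]].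
  move=> /allpairsPdep [[x' Q'] [w' [/= /sub[/= t2 u2 s2] wQ' ->]]] /= [Ex Ew].
  move: wQ wQ'; rewrite !mem_preimages // -Ew -Ex => /eqP -> /eqP [->] //.
case: P tP {uP szP sub} => r1 r2 [_ _ /= szr _]; rewrite /removals /=.
case: ifP => _; case: ifP => //= lt; rewrite inE andbT.
by apply/eqP => -[_ _] /(congr1 (@size nat)); rewrite size_take; case: ifP; lia.
Qed.

(** Only the shape matters: the two removals lead to the two terms of the ballot
recursion, and the first one is forbidden exactly when its term vanishes. *)
Lemma size_preimages n P : tableau2 P -> uniq (entries P) ->
  size (entries P) = n -> size (preimages n P) = ballot n (size P.2).
Proof.
elim: n P => [|n IHn] P tP uP szP.
  move: szP; rewrite size_cat => szP.
  by have -> : size P.2 = 0 by lia.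
have sub xQ : xQ \in removals P ->
    size (preimages n xQ.2) = ballot n (size xQ.2.2).
  case: xQ => x Q /(removalsP tP uP) [tQ pQ _]; apply: IHn => //=.
    by move: uP; rewrite -(perm_uniq pQ) => /andP [].
  by have := perm_size pQ => /=; lia.
rewrite /= size_allpairs_dep.
rewrite (_ : [seq _ | _ <- _] =
  [seq ballot n (size xQ.2.2) | xQ <- removals P]); last exact/eq_in_map.
case: P tP szP {uP sub} => r1 r2 [_ _ /= szr _]; rewrite size_cat /= => szP.
rewrite /removals /= map_cat sumn_cat (ifT (b := 2 * _ <= _)); last by lia.
congr (_ + _).
  case: ifP => [_|ge] /=; first by rewrite addn0.
  by case: n szP {IHn} => [|n] szP /=; rewrite ifF //; lia.
case: r2 szr szP => //= a r2 _ _.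
by rewrite addn0 size_take /= ltnSn.
Qed.

(** * Standard tableaux with two rows *)

(** Standard tableaux of shape [(n-k, k)], generated by adding the largest entry at
the end of either row. *)
Fixpoint std_tabs (n k : nat) : seq (seq nat * seq nat) :=
  if 2 * k <= n then
    if n is n'.+1 then
      [seq (rcons P.1 n, P.2) | P <- std_tabs n' k] ++
      (if k is k'.+1 then [seq (P.1, rcons P.2 n) | P <- std_tabs n' k']
       else [::])
    else [:: ([::], [::])]
  else [::].

Lemma size_std_tabs n k : size (std_tabs n k) = ballot n k.
Proof.
elim: n k => [|n IHn] k /=; case: ifP => // _.
rewrite size_cat size_map IHn; case: k => // k.
by rewrite size_map IHn.
Qed.

Lemma iotaSr_perm n : perm_eq (iota 1 n.+1) (n.+1 :: iota 1 n).
Proof. by have := iotaD 1 n 1; rewrite addn1 add1n => ->; rewrite perm_catC. Qed.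

(** The largest entry ends its row, and removing it leaves a standard tableau.  If
it ends the first row, that row is strictly longer than the second, since
otherwise a larger entry would stand below it. *)
Lemma mem_std_tabs n k (P : seq nat * seq nat) : P \in std_tabs n k <->
  [/\ tableau2 P, perm_eq (entries P) (iota 1 n) & size P.2 = k].
Proof.
have szE Q m : perm_eq (entries Q) (iota 1 m) -> size Q.1 + size Q.2 = m.
  by move/perm_size; rewrite size_cat size_iota.
elim: n k P => [|n IHn] k P.
  split.
    by rewrite /=; case: ifP => // lek; rewrite inE => /eqP ->; split=> //=; lia.
  case: P => r1 r2 [tP /szE /= sz <-].
  have -> : r1 = [::] by apply: size0nil; lia.
  by have -> : r2 = [::] by apply: size0nil; lia.
have bound Q : perm_eq (entries Q) (iota 1 n) ->
    forall z, z \in Q.1 \/ z \in Q.2 -> z < n.+1.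
  move=> pQ z zQ; have: z \in entries Q by rewrite mem_cat; apply/orP.
  by rewrite (perm_mem pQ) mem_iota; lia.
have sorted_ext r : sorted ltn r -> (forall z, z \in r -> z < n.+1) ->
    sorted ltn (rcons r n.+1).
  move=> sr lt; rewrite sorted_rcons sr /=; case: r lt {sr} => //= a r; apply.
  exact: mem_last.
split=> [|[tP pP szP]].
  rewrite /=; case: ifP => // lek; rewrite mem_cat => /orP [/mapP|].
    case=> Q /IHn [[s1 s2 sz cols] pQ szQ] ->; split=> //=.
      split=> //=; first by apply: sorted_ext => // z zQ; apply: (bound Q) => //; left.
        by rewrite size_rcons; lia.
      by move=> j lj; rewrite nth_rcons ifT ?cols //; lia.
    rewrite perm_sym; apply: (perm_trans (iotaSr_perm n)).
    by rewrite /entries /= cat_rcons perm_sym -cat1s perm_catCA /= perm_cons.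
  case: k lek => // k lek /mapP [Q /IHn [[s1 s2 sz cols] pQ szQ] ->].
  have szs := szE _ _ pQ.
  split=> //=; last by rewrite size_rcons szQ.
    split=> //=; first by apply: sorted_ext => // z zQ; apply: (bound Q) => //; right.
      by rewrite size_rcons; lia.
    move=> j; rewrite size_rcons nth_rcons => lj.
    case: (ltnP j (size Q.2)) => lj'; first exact: cols.
    have -> : j = size Q.2 by apply/eqP; rewrite eqn_leq lj' -ltnS lj.
    rewrite eqxx.
    apply: (bound Q) => //; left; apply: mem_nth.
    by rewrite -(leq_add2r (size Q.2)) addSn szs szQ addnn; lia.
  rewrite perm_sym; apply: (perm_trans (iotaSr_perm n)).
  by rewrite perm_sym /entries /= -rcons_cat perm_rcons perm_cons.
have {}bound z : z \in P.1 \/ z \in P.2 -> z <= n.+1.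
  move=> zP; have: z \in entries P by rewrite mem_cat; apply/orP.
  by rewrite (perm_mem pP) mem_iota; lia.
have szs := szE _ _ pP.
have: n.+1 \in entries P by rewrite (perm_mem pP) mem_iota; lia.
have pP' := perm_trans pP (iotaSr_perm n).
case: P tP {pP} szP bound szs pP' => r1 r2 [/= s1 s2 sz cols] szP bound szs pP.
rewrite mem_cat => mP /=; rewrite ifT; last by lia.
case/orP: mP => mP.
  have [r E sr] := sorted_max_last s1 mP (fun z h => bound z (or_introl h)).
  rewrite mem_cat; apply/orP; left; apply/mapP; exists (r, r2); rewrite ?E //.
  have lt : size r2 <= size r.
    rewrite leqNgt; apply/negP => lt; have szr : size r2 = (size r).+1.
      by move: sz; rewrite E size_rcons; lia.
    have := cols (size r) ltac:(lia); rewrite E nth_rcons ltnn eqxx.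
    by have := bound (nth 0 r2 (size r)); rewrite mem_nth ?szr //; lia.
  apply/IHn; split=> //=.
    split=> //= j lj; have := cols j lj; rewrite E nth_rcons ifT //; lia.
  by move: pP; rewrite /entries /= E cat_rcons -(cat1s n.+1 r2) perm_catCA /= perm_cons.
have [r E sr] := sorted_max_last s2 mP (fun z h => bound z (or_intror h)).
rewrite mem_cat; apply/orP; right; rewrite -szP E size_rcons.
apply/mapP; exists (r1, r) => //=.
apply/IHn; split=> //=.
  split=> //=; first by rewrite E size_rcons in sz; lia.
  by move=> j lj; have := cols j; rewrite E size_rcons nth_rcons lj; apply; lia.
by move: pP; rewrite /entries /= E -rcons_cat perm_rcons perm_cons.
Qed.

Lemma uniq_std_tabs n k : uniq (std_tabs n k).
Proof.
elim: n k => [|n IHn] k /=; case: ifP => // _.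
rewrite cat_uniq map_inj_uniq ?IHn /=; last first.
  by move=> [a b] [c d] /= [/rcons_inj [->] ->].
case: k => [//|k]; rewrite map_inj_uniq ?IHn /= ?andbT; last first.
  by move=> [a b] [c d] /= [-> /rcons_inj [->]].
apply/hasPn => _ /mapP [Q /mem_std_tabs [_ pQ _] ->]; apply/mapP => -[Q' _ [E _]].
have : n.+1 \in entries Q by rewrite mem_cat E mem_rcons inE eqxx.
by rewrite (perm_mem pQ) mem_iota; lia.
Qed.

Lemma std_tabs_content n k (P : seq nat * seq nat) : P \in std_tabs n k ->
  [/\ tableau2 P, uniq (entries P), size (entries P) = n & size P.2 = k].
Proof.
case/mem_std_tabs => tP pP szP; split=> //.
  by rewrite (perm_uniq pP) iota_uniq.
by rewrite (perm_size pP) size_iota.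
Qed.

Definition two_row_words (n k : nat) : seq (seq nat) :=
  [seq w | P <- std_tabs n k, w <- preimages n P].

Lemma size_two_row_words n k : size (two_row_words n k) = ballot n k ^ 2.
Proof.
rewrite size_allpairs_dep.
rewrite (_ : [seq _ | _ <- _] = [seq ballot n k | _ <- std_tabs n k]); last first.
  apply/eq_in_map => P /std_tabs_content [tP uP sP kP].
  by rewrite size_preimages // kP.
by rewrite sumnE big_map big_const_seq count_predT iter_addn_0 size_std_tabs.
Qed.

Lemma uniq_two_row_words n k : uniq (two_row_words n k).
Proof.
apply: allpairs_uniq_dep => [|P /std_tabs_content []|]; first exact: uniq_std_tabs.
  by move=> tP uP sP _; apply: uniq_preimages.
move=> Pw1 Pw2 /allpairsPdep [P [w [/std_tabs_content[tP uP sP _] wP ->]]].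
move=> /allpairsPdep [P' [w' [/std_tabs_content[tP' uP' sP' _] wP' ->]]] /= E.
by move: wP wP'; rewrite !mem_preimages // -E => /eqP -> /eqP [->].
Qed.

Lemma mem_two_row_words n k (w : seq nat) : w \in two_row_words n k <->
  perm_eq w (iota 1 n) /\ exists2 P, rs2 w = Some P & size P.2 = k.
Proof.
split=> [/allpairsPdep [P [v [/mem_std_tabs[tP pP kP] + ->]]]|[pw [P E kP]]].
  rewrite mem_preimages ?(perm_uniq pP) ?iota_uniq //; last first.
    by rewrite (perm_size pP) size_iota.
  move/eqP=> E; split; last by exists P.
  by rewrite -(permPl (perm_rs2 E)).
have uw : uniq w by rewrite (perm_uniq pw) iota_uniq.
have tP := rs2_tableau uw E; have Pw := perm_rs2 E.
apply/allpairsPdep; exists P, w; split=> //.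
  by apply/mem_std_tabs; split=> //; apply: perm_trans pw.
by rewrite mem_preimages ?E ?(perm_uniq Pw) // (perm_size Pw) (perm_size pw) size_iota.
Qed.

(** * A third row appears exactly when the pattern does *)

(** The pattern 321 of a word that is read backwards. *)
Definition increasing3 (w : seq nat) : Prop :=
  exists x u z, [/\ subseq [:: x; u; z] w, x < u & u < z].

Lemma increasing3_cons x w : increasing3 (x :: w) ->
  increasing3 w \/ exists u z, [/\ subseq [:: u; z] w, x < u & u < z].
Proof.
case=> [a [u [z [s ltu ltz]]]]; move: s ltu => /=; case: eqP => [->|_] s ltu; last first.
  by left; exists a, u, z.
by right; exists u, z.
Qed.

Lemma increasing3_consr x w : increasing3 w -> increasing3 (x :: w).
Proof.
case=> [a [u [z [s l1 l2]]]]; exists a, u, z; split=> //.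
apply: subseq_trans s (subseq_cons _ _).
Qed.

(** In a word that is read backwards, [subseq [:: u; z] w] with [u < z] is a descent
with upper letter [z].  When [y] is smaller than an entry [z] of the second
row, such a [u >= y] exists: the letter that bumped [z], or [y] itself if it
came later. *)
Definition row_pairs_from_word (w : seq nat) (P : seq nat * seq nat) : Prop :=
  forall y z, y \in P.1 -> z \in P.2 -> y < z ->
  exists2 u, subseq [:: u; z] w & y <= u < z.

(** A converse of [row_pairs_from_word]: a letter smaller than [u] bumps an entry of
the first row that is at most [y], which cannot go at the end of a second row
containing [z']. *)
Definition word_pairs_in_rows (w : seq nat) (P : seq nat * seq nat) : Prop :=
  forall u z, subseq [:: u; z] w -> u < z ->
  exists y z', [/\ y \in P.1, z' \in P.2 & u <= y < z'].

(** If the entry [y0] bumped by [x] is below some [z] of the second row, the first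
invariant gives a descent [z .. u] with [x < y0 <= u], hence the pattern.  If
the pattern ends at [x], the second invariant gives an entry [y > x] of the
first row below an entry of the second one, so that neither case of a
successful insertion is possible. *)
Lemma rs2_increasing3 w : uniq w ->
  if rs2 w is Some P then
    [/\ row_pairs_from_word w P, word_pairs_in_rows w P & ~ increasing3 w]
  else increasing3 w.
Proof.
elim: w => [_|x w IHw] /=; first by split=> // -[a [u [z [] //]]].
case/andP=> xw uw; move: (IHw uw); have := @rs2_tableau w; have := @perm_rs2 w.
case: (rs2 w) {IHw} => [[r1 r2]|] /=; last by move=> _ _; apply: increasing3_consr.
move=> /(_ _ erefl) pw /(_ _ uw erefl) [/= s1 s2 sz cols] [rw wr no3].
have memw (z : nat) : (z \in w) = (z \in r1) || (z \in r2).
  by rewrite -(perm_mem pw) mem_cat.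
have [x1 x2] : x \notin r1 /\ x \notin r2 by move: xw; rewrite memw negb_or => /andP.
have old (u z : nat) : subseq [:: u; z] w -> subseq [:: u; z] (x :: w).
  by move/subseq_trans; apply; apply: subseq_cons.
have new (z : nat) : z \in w -> subseq [:: x; z] (x :: w).
  by move=> zw; rewrite /= eqxx sub1seq.
have inv (u z : nat) : subseq [:: u; z] (x :: w) ->
    (u = x /\ z \in w) \/ subseq [:: u; z] w.
  by rewrite [subseq _ _]/=; case: eqP => [->|_ h]; [rewrite sub1seq; left | right].
have fd := sorted_find s1 x1; rewrite /insert2 /=.
set i := find _ _ in fd *.
have big (z : nat) : z \in r1 -> x < z -> i < size r1 /\ nth 0 r1 i <= z.
  move=> /(nthP 0) [j ltj <-] ltx.
  have {}ltj : j < size r1 := ltj; have {}ltx : x < nth 0 r1 j := ltx.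
  have lij : i <= j by have := fd _ ltj; lia.
  split; first by lia.
  have [->//|ne] := eqVneq i j.
  by apply: ltnW; apply: sorted_nth => //; lia.
case: ifP => [lti|gei]; last first.
  (* No entry of the first row exceeds [x], which goes at its end. *)
  split.
  - move=> y z yr zr lt; have zr2 : z \in r2 := zr.
    have : y \in rcons r1 x := yr.
    rewrite mem_rcons inE => /orP [/eqP Ey|yr1].
      exists x; [by apply: new; rewrite memw zr2 orbT | ].
      by rewrite Ey leqnn -Ey.
    by have [u su lu] := rw y z yr1 zr2 lt; exists u => //; apply: old.
  - move=> u z /inv [[-> zw]|s] lt /=.
      exists x, z; rewrite mem_rcons inE eqxx leqnn lt; split=> //.
      by move: zw; rewrite memw => /orP [/big/(_ lt)[]|//]; lia.
    have [y [z' [yr1 zr2 l]]] := wr u z s lt.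
    by exists y, z'; rewrite mem_rcons inE yr1 orbT.
  - case/increasing3_cons => // -[u [z [s lxu luz]]].
    have [y [z' [yr1 zr2 l]]] := wr u z s luz.
    by have [] := big y yr1 ltac:(lia); lia.
set y0 := nth 0 r1 i.
have lxy : x < y0.
  by rewrite /y0; move: (nth_find 0 (a := ltn x) (s := r1)); apply; rewrite has_find.
have y0r1 : y0 \in r1 by apply: mem_nth.
case: ifP => [lasty|lasty] /=; last first.
  have zr2 : last 0 r2 \in r2.
    by case: (r2) lasty => //= a r _; apply: mem_last.
  have [u s /andP [l1 l2]] := rw y0 (last 0 r2) y0r1 zr2 ltac:(lia).
  exists x, u, (last 0 r2); split; rewrite ?l2 //; last by lia.
  by rewrite /= eqxx.
(* [y0] goes at the end of the second row. *)
have le_y0 (z : nat) : z \in r2 -> z <= y0.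
  by move/(sorted_le_last s2); lia.
split.
- move=> y z yr zr' lt; have zr : z \in rcons r2 y0 := zr'.
  have [Ey|yr1] := mem_set_nth_or lti yr.
    exists x; last by rewrite Ey leqnn -Ey.
    apply: new; rewrite memw.
    by move: zr; rewrite mem_rcons inE => /orP [/eqP ->|->]; rewrite ?y0r1 ?orbT.
  move: zr; rewrite mem_rcons inE => /orP [/eqP Ez|zr2].
    exists x; first by apply: new; rewrite memw Ez y0r1.
    rewrite Ez lxy andbT leqNgt; apply/negP => /(big _ yr1) []; rewrite -/y0; lia.
  by have [u su lu] := rw y z yr1 zr2 lt; exists u => //; apply: old.
- move=> u z /inv [[-> zw]|s] lt /=.
    exists x, y0; rewrite mem_set_nth_new // mem_rcons inE eqxx leqnn lxy.
    by [].
  have [y [z' [yr1 zr2 l]]] := wr u z s lt.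
  exists y, z'; rewrite mem_set_nth_old ?mem_rcons ?inE ?zr2 ?orbT //.
  by have := le_y0 _ zr2; rewrite -/y0; lia.
- case/increasing3_cons => // -[u [z [s lxu luz]]].
  have [y [z' [yr1 zr2 l]]] := wr u z s luz.
  have [_] := big y yr1 ltac:(lia); have := le_y0 _ zr2; rewrite -/y0; lia.
Qed.

(** * Comparison with insertion into arbitrarily many rows *)

(** Empty rows are not listed, as [rs_insert] creates a row only when it first
receives an entry. *)
Definition rows (P : seq nat * seq nat) : seq (seq nat) :=
  if nilp P.1 then [::] else if nilp P.2 then [:: P.1] else [:: P.1; P.2].

(** The bump count is the length of the second row: a bump from the first row
lengthens the second one, and nothing else happens when [insert2] succeeds. *)
Lemma rs_step_insert2 (x : nat) P P' : tableau2 P -> x \notin P.1 ->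
  insert2 x P = Some P' -> rs_step (rows P, size P.2) x = (rows P', size P'.2).
Proof.
case: P => r1 r2 [/= s1 s2 sz cols] x1; rewrite /insert2 /= /rows /=.
have [n1|n1] := boolP (nilp r1).
  have -> : r1 = [::] by apply: size0nil; apply/eqP.
  have -> /= : r2 = [::] by apply: size0nil; move: n1; rewrite /nilp; lia.
  by case=> <-.
have fd := sorted_find s1 x1; set i := find _ _ in fd *.
have pos : 0 < size r1 by rewrite lt0n.
have lastE : (last 0 r1 <= x) = ~~ (i < size r1).
  have ne : last 0 r1 != x.
    by apply: contraNneq x1 => <-; rewrite -nth_last mem_nth // ltn_predL.
  by have := fd (size r1).-1 ltac:(lia); rewrite nth_last; lia.
have E : rs_insert (if nilp r2 then [:: r1] else [:: r1; r2]) x =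
    if i < size r1 then
      let: (Q, b) := rs_insert (if nilp r2 then [::] else [:: r2]) (nth 0 r1 i) in
      (set_nth 0 r1 i x :: Q, b.+1)
    else (rcons r1 x :: (if nilp r2 then [::] else [:: r2]), 0).
  by case: (nilp r2); rewrite /= (negbTE n1) lastE; case: (i < size r1).
rewrite E; case: ifP => [lti|gei]; last first.
  case=> <- /=; rewrite addn0; congr pair.
  by rewrite /nilp size_rcons /=; case: eqP.
case: ifP => // lasty [<-] /=.
have -> : rs_insert (if nilp r2 then [::] else [:: r2]) (nth 0 r1 i) =
    ([:: rcons r2 (nth 0 r1 i)], 0).
  by case: (r2) lasty => //= a r ->.
by rewrite /nilp size_set_nth !size_rcons addn1 ifF //; lia.
Qed.

Lemma rs_foldr w P : uniq w -> rs2 w = Some P ->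
  foldr (fun x st => rs_step st x) ([::], 0) w = (rows P, size P.2).
Proof.
elim: w P => [|x w IHw] P /=; first by move=> _ [<-].
case/andP=> xw uw; have := @perm_rs2 w; have := @rs2_tableau w.
case: (rs2 w) IHw => //= Q /(_ Q uw erefl) -> /(_ Q uw erefl) tQ /(_ Q erefl) Qw.
apply: rs_step_insert2 => //; apply: contra xw => xQ.
by rewrite -(perm_mem Qw) mem_cat xQ.
Qed.

(** * Permutations as words *)

Definition word (n : nat) (s : 'S_n) : seq nat := rev (one_line s).

Lemma perm_word n (s : 'S_n) : perm_eq (word s) (iota 1 n).
Proof.
rewrite /word (permPl (permEl (perm_rev _))).
have -> : iota 1 n = [seq (val i).+1 | i <- enum 'I_n].
  by rewrite (map_comp S val) val_enum_ord -[1]/(1 + 0) iotaDl.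
rewrite /one_line (map_comp (fun i : 'I_n => (val i).+1) s).
apply: perm_map; apply: uniq_perm; rewrite ?enum_uniq //.
  by rewrite map_inj_uniq ?enum_uniq //; apply: perm_inj.
move=> i; rewrite mem_enum; apply/mapP; exists (s^-1%g i); rewrite ?mem_enum //.
by rewrite permKV.
Qed.

Lemma uniq_word n (s : 'S_n) : uniq (word s).
Proof. by rewrite (perm_uniq (perm_word s)) iota_uniq. Qed.

Lemma size_one_line n (s : 'S_n) : size (one_line s) = n.
Proof. by rewrite /one_line size_map size_enum_ord. Qed.

Lemma nth_one_line n (s : 'S_n) (i : 'I_n) : nth 0 (one_line s) i = (s i).+1.
Proof. by rewrite /one_line (nth_map i) ?size_enum_ord // nth_ord_enum. Qed.

Lemma word_inj n : injective (@word n).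
Proof.
move=> s t /(can_inj revK) E; apply/permP => i.
have := nth_one_line s i; rewrite E nth_one_line => -[E'].
exact/esym/val_inj.
Qed.

Lemma word_surj n (w : seq nat) : perm_eq w (iota 1 n) -> exists s : 'S_n, word s = w.
Proof.
move=> pw; have szw : size w = n by rewrite (perm_size pw) size_iota.
have uw : uniq w by rewrite (perm_uniq pw) iota_uniq.
have bound (i : 'I_n) : 0 < nth 0 (rev w) i < n.+1.
  have : nth 0 (rev w) i \in iota 1 n.
    by rewrite -(perm_mem pw) -mem_rev mem_nth // size_rev szw.
  by rewrite mem_iota; lia.
have lt (i : 'I_n) : (nth 0 (rev w) i).-1 < n by have := bound i; lia.
have inj : injective (fun i : 'I_n => Ordinal (lt i)).
  move=> i j /(congr1 val) /= E; apply/val_inj/eqP => /=.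
  have {}E : nth 0 (rev w) i = nth 0 (rev w) j.
    by have := bound i; have := bound j; lia.
  by rewrite -(nth_uniq 0 (s := rev w)) ?size_rev ?szw ?rev_uniq ?E.
exists (perm inj); rewrite /word; apply: (can_inj revK); rewrite revK.
apply: (@eq_from_nth _ 0) => [|i].
  by rewrite size_one_line size_rev.
rewrite size_one_line => lti.
rewrite (nth_one_line _ (Ordinal lti)) permE /=.
by have := bound (Ordinal lti) => /=; lia.
Qed.

Lemma avoids321_word n (s : 'S_n) : avoids321 s <-> ~ increasing3 (word s).
Proof.
rewrite /avoids321; split.
  move/negP=> no [x [u [z [sub ltx ltz]]]]; apply: no.
  move: sub; rewrite -[[:: x; u; z]]revK subseq_rev => /subseqP [m _].
  rewrite /one_line -map_mask /rev /=.
  case E: (mask m (enum 'I_n)) => [|a [|b [|c [|? ?]]]] //= [Ez Eu Ex].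
  have : subseq [seq val i | i <- [:: a; b; c]] (iota 0 n).
    by rewrite -val_enum_ord; apply: map_subseq; rewrite -E mask_subseq.
  move/(subseq_sorted ltn_trans)/(_ (iota_ltn_sorted 0 n)) => /= /and3P [ab bc _].
  apply/existsP; exists a; apply/existsP; exists b; apply/existsP; exists c.
  by rewrite ab bc; lia.
move=> no; apply/negP => /existsP [a /existsP [b /existsP [c /and4P [ab bc sba scb]]]].
apply: no; exists (s c).+1, (s b).+1, (s a).+1; split; rewrite ?ltnS //.
have -> : [:: (s c).+1; (s b).+1; (s a).+1] = rev [seq (val (s i)).+1 | i <- [:: a; b; c]].
  by [].
rewrite subseq_rev; apply: map_subseq.
(* An increasing list of indices is the sublist of the enumeration that it
   selects. *)
have -> : [:: a; b; c] = [seq i <- enum 'I_n | i \in [:: a; b; c]].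
  apply: (inj_map val_inj); apply: (irr_sorted_eq ltn_trans ltnn).
  - by rewrite /= ab bc.
  - apply: (subseq_sorted ltn_trans (map_subseq _ (filter_subseq _ _))).
    by rewrite val_enum_ord iota_ltn_sorted.
  - by apply: eq_mem_map => i; rewrite mem_filter mem_enum andbT.
exact: filter_subseq.
Qed.

(** * The generating function *)

Lemma rs2_word n (s : 'S_n) : avoids321 s ->
  exists2 P, rs2 (word s) = Some P & size P.2 = Defs.bump s.
Proof.
move=> /avoids321_word no3; have := rs2_increasing3 (uniq_word s).
case E: (rs2 (word s)) => [P|] // _; exists P => //.
have := rs_foldr (uniq_word s) E.
by rewrite -foldl_rev revK /Defs.bump => ->.
Qed.

Lemma rs2_word_avoids n (s : 'S_n) P : rs2 (word s) = Some P -> avoids321 s.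
Proof.
move=> E; apply/avoids321_word; have := rs2_increasing3 (uniq_word s).
by rewrite E => -[].
Qed.

Lemma bump_le_half n (s : 'S_n) : avoids321 s -> Defs.bump s < n./2.+1.
Proof.
move=> /rs2_word [P E <-].
have le21 := size_rows (rs2_tableau (uniq_word s) E).
have szP : size P.1 + size P.2 = n.
  by rewrite -size_cat (perm_size (perm_rs2 E)) (perm_size (perm_word s)) size_iota.
lia.
Qed.

(** The words of these permutations are those whose insertion succeeds with a
tableau of shape [(n-k, k)]: [ballot n k] tableaux, [ballot n k] words each. *)
Lemma card_avoids321_bump n k :
  #|[set s : 'S_n | avoids321 s && (Defs.bump s == k)]| = ballot n k ^ 2.
Proof.
rewrite -size_two_row_words cardE -(size_map (@word n)).
apply/perm_size/uniq_perm; last move=> w.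
- by rewrite map_inj_uniq ?enum_uniq //; apply: word_inj.
- exact: uniq_two_row_words.
apply/mapP/idP => [[s + ->]|/mem_two_row_words [pw [P E kP]]].
  rewrite mem_enum inE => /andP [/rs2_word [P E <-] /eqP <-].
  by apply/mem_two_row_words; split; [exact: perm_word | exists P].
have [s Es] := word_surj pw; subst w; exists s => //.
have av := rs2_word_avoids E; rewrite mem_enum inE av.
by have [Q] := rs2_word av; rewrite E => -[<-] <-; apply/eqP.
Qed.

Lemma ballotE n k : 2 * k <= n ->
  (multinom_kk n k / ('C(n - k + 1, k))%:R = (ballot n k)%:R :> rat)%R.
Proof.
move=> le_kn; have := @ballot_closed n k ltac:(lia).
have := @bin_fact (n - k + 1) k ltac:(lia).
rewrite !addn1 -subSn; last by lia.
have -> : n.+1 - k - k = (n - 2 * k).+1 by lia.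
have -> : n.+1 - 2 * k = (n - 2 * k).+1 by lia.
rewrite /multinom_kk factS => Hbin Hbal.
have nz m : (m`!)%:R != 0%R :> rat by rewrite pnatr_eq0 -lt0n fact_gt0.
have binnz : ('C(n.+1 - k, k))%:R != 0%R :> rat.
  by rewrite pnatr_eq0 -lt0n bin_gt0; lia.
have Snz : ((n - 2 * k).+1)%:R != 0%R :> rat by rewrite pnatr_eq0.
have {}Hbin := congr1 (fun m => m%:R : rat)%R Hbin.
have {}Hbal := congr1 (fun m => m%:R : rat)%R Hbal.
rewrite !natrM in Hbin Hbal.
apply: (mulfI (nz (n.+1 - k))); apply: (mulfI (nz k)).
transitivity ((n`!)%:R * (n - 2 * k).+1%:R : rat)%R; last first.
  rewrite -Hbal; ring.
rewrite -Hbin; field.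
by rewrite !nz binnz.
Qed.

Local Open Scope ring_scope.

Theorem theorem23 (n : nat) (hn : (1 <= n)%N) :
  B321 n = 1 + \sum_(1 <= k < n./2.+1)
    (multinom_kk n k ^+ 2 / ('C(n - k + 1, k))%:R ^+ 2) *: 'X^k.
Proof.
(* Grouping the permutations by their bump count, which is at most [n./2]. *)
transitivity (\sum_(k < n./2.+1) ((ballot n k)%:R ^+ 2 : rat) *: 'X^k : {poly rat}).
  rewrite /B321 (partition_big (fun s => inord (Defs.bump s) : 'I_n./2.+1) xpredT) //=.
  apply: eq_bigr => k _.
  rewrite -natrX -(card_avoids321_bump n k) scaler_nat -sumr_const.
  apply: eq_big => [s|s /andP [av /eqP <-]].
    rewrite inE; apply: andb_id2l => av.
    by rewrite -val_eqE /= inordK // bump_le_half.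
  by rewrite inordK // bump_le_half.
rewrite -(big_mkord xpredT (fun k => ((ballot n k)%:R ^+ 2) *: 'X^k)).
rewrite big_ltn // ballotn0 expr1n scale1r; congr (_ + _).
apply: eq_big_nat => k /andP [_ lek].
by rewrite -ballotE ?expr_div_n //; lia.
Qed.
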